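(* Fix positive integers $k,t$ with $k \geqslant 2t+1$, and let $\ell=\ell(n)$ be a function with $n^{k-t-1} = o(\ell)$ as $n\to\infty$ (and $\ell\le\binom{n}{k}$). Then, as $n \to \infty$, $$\rho(\ell) \geqslant (1+o(1)) \cdot \frac{\ell^{2}}{n^{t}} \cdot \frac{t!}{2}.$$
   Context: For positive integers $n,k,t$, the generalized Johnson graph $G(n,k,t)$ has vertex set $\binom{[n]}{k}$ (all $k$-element subsets of $[n]=\{1,\dots,n\}$), and two $k$-sets $F_1,F_2$ are adjacent iff $|F_1\cap F_2|=t$. For a family $\mathcal{F}\subset\binom{[n]}{k}$, $\rho(\mathcal{F})$ denotes the number of unordered pairs $\{F_1,F_2\}\subset\mathcal{F}$ with $|F_1\cap F_2|=t$, and $\rho(\ell)=\min\{\rho(\mathcal{F}) : \mathcal{F}\subset\binom{[n]}{k}, |\mathcal{F}|=\ell\}$ (the minimum number of edges in an induced subgraph of $G(n,k,t)$ on $\ell$ vertices). Asymptotic notation refers to $n\to\infty$ with $k,t$ fixed. *)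

(* Defs.v *)
From mathcomp Require Import all_boot.

Set Implicit Arguments.
Unset Strict Implicit.
Unset Printing Implicit Defensive.

(* Vertices are sets A : {set 'I_n} with #|A| = k; 'I_n plays the role of [n]. *)
Definition johnson_adj (n t : nat) : rel {set 'I_n} :=
  fun A B => #|A :&: B| == t.

Definition ksets (n k : nat) : {set {set 'I_n}} :=
  [set A : {set 'I_n} | #|A| == k].

(* Edges are unordered pairs, encoded as two-element sets [set A; B]. *)
Definition rho_fam (n t : nat) (F : {set {set 'I_n}}) : nat :=
  #|[set [set A; B] | A in F, B in F & (A != B) && johnson_adj t A B]|.

(* The default value of the minimum is the edge count of the whole graph, which
   bounds every [rho_fam t F] from above: when l <= 'C(n, k), it does not affect
   the minimum (lemmas [rho_attained] and [rho_le]). *)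
Definition rho (n k t l : nat) : nat :=
  \big[minn/rho_fam t (ksets n k)]_(F : {set {set 'I_n}} |
      (F \subset ksets n k) && (#|F| == l)) rho_fam t F.

Lemma rho_fam_mono (n t : nat) (F G : {set {set 'I_n}}) :
  F \subset G -> rho_fam t F <= rho_fam t G.
Proof.
move=> /subsetP FG; apply/subset_leq_card/subsetP => E.
case/imset2P => A B AF; rewrite inE => /andP[BF adjAB] ->.
by apply/imset2P; exists A B; rewrite ?inE ?adjAB ?FG.
Qed.

Lemma rho_le (n k t : nat) (F : {set {set 'I_n}}) :
  F \subset ksets n k -> rho n k t #|F| <= rho_fam t F.
Proof.
move=> Fk; have := mem_index_enum F; rewrite /rho.
elim: (index_enum _) => //= G s IHs; rewrite inE big_cons.
case/predU1P => [<-|/IHs le_s]; first by rewrite Fk eqxx geq_min leqnn.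
by case: ifP; rewrite ?geq_min ?le_s ?orbT.
Qed.

Lemma rho_attained (n k t l : nat) : l <= 'C(n, k) ->
  exists F : {set {set 'I_n}},
    [/\ F \subset ksets n k, #|F| = l & rho n k t l = rho_fam t F].
Proof.
move=> le_l.
have [F0 F0k cF0]: exists2 F : {set {set 'I_n}}, F \subset ksets n k & #|F| = l.
  have ck : #|ksets n k| = 'C(n, k) by rewrite /ksets card_draws card_ord.
  exists [set A in take l (enum (ksets n k))].
    by apply/subsetP => A; rewrite inE => /mem_take; rewrite mem_enum.
  rewrite cardsE; have /card_uniqP -> : uniq (take l (enum (ksets n k))).
    exact/take_uniq/enum_uniq.
  by rewrite size_takel // -cardE ck.
have : rho n k t l = rho_fam t (ksets n k) \/
  exists F : {set {set 'I_n}},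
    [/\ F \subset ksets n k, #|F| = l & rho n k t l = rho_fam t F].
  rewrite /rho; elim/big_rec: _ => [|F x /andP[Fk /eqP cF] IH]; first by left.
  rewrite /minn; case: ifP => _ //; right; by exists F.
case=> // rhoE; exists F0; split=> //; apply/eqP; rewrite eqn_leq.
by rewrite -{1}cF0 rho_le //= rhoE rho_fam_mono.
Qed.

(* Main.v *)
Require Import Defs.
From mathcomp Require Import all_boot all_order all_algebra zify ring lra.

(* Let d(S) be the number of members of the family containing S, and call S
   closed in a member F if d(S + x) <= d(S) / M for every x in F \ S.  If T is a
   closed t-subset of F, almost all members through T meet F exactly in T.  So
   once almost every F has been given such a T(F), there are about
   \sum_T d(T)^2 >= l^2 / C(n, t) ordered pairs meeting in t points.

   Why T(F) exists: since l >> n^(k-t-1), for almost all F no (k-t-1)-subset of F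
   has bounded degree, hence each of them lies in a proper closed subset of F; and
   for almost all F an intersection of closed subsets is closed, up to enlarging
   1/M.  In a closure system on k >= 2t+1 points where spanning sets have at least
   k-t points, let B be a minimal spanning set and H_x, for x in B, a proper
   closed set containing B - x.  For X a subset of B, the intersection of the H_x
   over x in B \ X has |X| + #{e in F \ B : E_e \subset X} points, with
   E_e = {x in B : e \notin H_x}, and a theorem of Frankl and Katona on finite set systems provides an X for which
   this number is t.  It is proved by a double count over nonincident pairs in the
   style of de Bruijn and Erdos. *)

Set Implicit Arguments.
Unset Strict Implicit.
Unset Printing Implicit Defensive.

Import Order.TTheory GRing.Theory Num.Theory.

(** * Set systems: a vertex set of prescribed weight *)

(** Serves the critical case [#|V| = #|D|.+1] of [subset_with_weight]: putting [E i] inside X and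
    [z] outside discards at least as many edges through [z] as it commits vertices of [E i]. *)
Lemma small_nonincident_edge (T I : finType) (V : {set T}) (D : {set I})
    (E : I -> {set T}) :
    #|V| = #|D|.+1 -> (forall i, i \in D -> E i \proper V) ->
    (forall z, z \in V -> exists2 i, i \in D & z \notin E i) ->
  exists z i, [/\ z \in V, i \in D, z \notin E i
    & #|E i| <= #|[set j in D | z \in E j]|].
Proof.
move=> cV EV miss.
have [/existsP[z /existsP[i /and4P[? ? ? ?]]]|] := boolP [exists z, exists i,
    [&& z \in V, i \in D, z \notin E i & #|E i| <= #|[set j in D | z \in E j]|]].
  by exists z, i.
rewrite negb_exists => /forallP small.
have {}small z i : z \in V -> i \in D -> z \notin E i ->
    #|[set j in D | z \in E j]| < #|E i|.
  move=> zV iD zi; have := small z; rewrite negb_exists => /forallP/(_ i).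
  by rewrite zV iD zi /= -ltnNge.
pose m := #|D|; pose d z := #|[set j in D | z \in E j]|.
have dE z : #|[set i in D | z \notin E i]| = m - d z.
  rewrite /m -(cardsID [set j | z \in E j] D) /d.
  have -> : [set i in D | z \notin E i] = D :\: [set j | z \in E j].
    by apply/setP=> j; rewrite !inE andbC.
  have -> : [set j in D | z \in E j] = D :&: [set j | z \in E j].
    by apply/setP=> j; rewrite !inE.
  by rewrite addKn.
have d_lt z : z \in V -> d z < m.
  move=> /miss[i iD zi]; rewrite -subn_gt0 -dE; apply/card_gt0P; exists i.
  by rewrite inE iD.
have kE i : i \in D -> #|[set z in V | z \notin E i]| = m.+1 - #|E i|.
  move=> /EV/proper_sub/setIidPr EiV; rewrite -cV -(cardsID (E i) V) EiV addKn.
  by congr #|pred_of_set _|; apply/setP=> z; rewrite !inE andbC.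
have k_lt i : i \in D -> #|E i| < m.+1 by move=> /EV/proper_card; rewrite cV.
(* If every nonincident pair had |E i| > d z, then a z < b i on such pairs, but
   both weights have total 1. *)
pose a z : rat := ((m.+1 * (m - d z))%:R^-1)%R.
pose b i : rat := ((m * (m.+1 - #|E i|))%:R^-1)%R.
(* From [d z < #|E i|] follows m + 1 - |E i| <= m - d z; the factors m < m + 1 make the comparison
   strict. *)
have ab z i : z \in V -> i \in D -> z \notin E i -> (a z < b i)%R.
  move=> zV iD zi; have := d_lt z zV; have := k_lt i iD.
  have : d z < #|E i| by exact: small.
  move=> dk km dm; rewrite /a /b ltf_pV2 ?qualifE /= ?ltr0n ?ltr_nat; nia.
have : (\sum_(z in V) \sum_(i in D | z \notin E i) a z <
        \sum_(z in V) \sum_(i in D | z \notin E i) b i)%R.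
  apply: ltr_sum => [|z zV].
    by apply/hasP; have /card_gt0P[z zV] : 0 < #|V| by [rewrite cV];
       exists z; rewrite ?mem_index_enum.
  apply: ltr_sum => [|i /andP[iD zi]]; last exact: ab.
  apply/hasP; have [i iD zi] := miss z zV.
  by exists i; rewrite ?mem_index_enum ?iD.
rewrite [X in (_ < X)%R](exchange_big_dep (mem D)) => [|z i _ /andP[]//] /=.
have -> : (\sum_(z in V) \sum_(i in D | z \notin E i) a z = 1)%R.
  transitivity (\sum_(z in V) (m.+1%:R^-1 : rat))%R.
    apply: eq_bigr => z zV; rewrite sumr_const.
    have -> : #|[pred i in D | z \notin E i]| = m - d z.
      by rewrite -dE; apply: eq_card => i; rewrite !inE.
    rewrite /a natrM invfM -[RHS]mulr1 -mulrnAr; congr (_ * _)%R.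
    have := d_lt z zV; rewrite -subn_gt0 -[LHS]mulr_natr; move: (m - d z) => c c0.
    by rewrite mulVf // pnatr_eq0 -lt0n.
  by rewrite sumr_const cV -[LHS]mulr_natr mulVf ?pnatr_eq0.
have m0 : 0 < m.
  have /card_gt0P[z zV] : 0 < #|V| by rewrite cV.
  exact: leq_ltn_trans (d_lt z zV).
suff -> : (\sum_(i in D) \sum_(z in V | (i \in D) && (z \notin E i)) b i = 1)%R.
  by rewrite ltxx.
transitivity (\sum_(i in D) (m%:R^-1 : rat))%R.
  apply: eq_bigr => i iD; rewrite sumr_const.
  have -> : #|[pred z in V | (i \in D) && (z \notin E i)]| = m.+1 - #|E i|.
    by rewrite -kE //; apply: eq_card => z; rewrite !inE iD.
  rewrite /b natrM invfM -[RHS]mulr1 -mulrnAr; congr (_ * _)%R.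
  have := k_lt i iD; rewrite -subn_gt0 -[LHS]mulr_natr.
  move: (m.+1 - #|E i|) => c c0.
  by rewrite mulVf // pnatr_eq0 -lt0n.
by rewrite sumr_const -/m -[LHS]mulr_natr mulVf ?pnatr_eq0 -?lt0n.
Qed.

(* A form of the Frankl-Katona theorem: if the intersection of any r >= 1
   members of a family of subsets of [n] has size different from r - 1, the
   family has at most n members. *)
Lemma subset_with_weight (T I : finType) (V : {set T}) (D : {set I})
    (E : I -> {set T}) (s : nat) :
    (forall i, i \in D -> E i \subset V) -> #|D| <= s < #|V| ->
  exists2 X : {set T}, X \subset V & #|X| + #|[set i in D | E i \subset X]| = s.
Proof.
have [N] := ubnP (#|V| + #|D|); elim: N V D E s => // N IH V D E s.
rewrite ltnS => leN EV /andP[Ds sV].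
(* Look for X containing W and avoiding Z: edges inside W are counted, edges
   meeting Z are lost, the others are traced on the remaining vertices. *)
have contract (W Z : {set T}) : W \subset V -> Z \subset V -> [disjoint W & Z] ->
    W :|: Z != set0 -> #|W :|: Z| < #|V| ->
    #|W| + #|D| <= #|[set i in D | ~~ [disjoint E i & Z]]| + s ->
    #|Z| + s < #|[set i in D | E i \subset W]| + #|V| ->
  exists2 X : {set T}, X \subset V & #|X| + #|[set i in D | E i \subset X]| = s.
  move=> WV ZV dWZ WZ0 WZV leW leZ.
  pose eW := [set i in D | E i \subset W].
  pose dZ := [set i in D | ~~ [disjoint E i & Z]].
  have deWZ : [disjoint eW & dZ].
    rewrite -setI_eq0; apply/eqP/setP=> i; rewrite !inE.
    case: (boolP (E i \subset W)) => [EiW|]; last by rewrite andbF.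
    by rewrite (disjointWl EiW dWZ) !andbF.
  pose D' := D :\: (eW :|: dZ); pose V' := V :\: (W :|: Z).
  have cWZ : #|W :|: Z| = #|W| + #|Z|.
    by rewrite cardsU (disjoint_setI0 dWZ) cards0 subn0.
  have ceWZ : #|eW :|: dZ| = #|eW| + #|dZ|.
    by rewrite cardsU (disjoint_setI0 deWZ) cards0 subn0.
  have eWZD : eW :|: dZ \subset D.
    by apply/subsetP=> i; rewrite !inE => /orP[] /andP[].
  have WZsV : W :|: Z \subset V by rewrite subUset WV.
  have cD : #|D'| + (#|eW| + #|dZ|) = #|D|.
    by rewrite /D' cardsD (setIidPr eWZD) -ceWZ subnK // subset_leq_card.
  have cV : #|V'| + (#|W| + #|Z|) = #|V|.
    by rewrite /V' cardsD (setIidPr WZsV) -cWZ subnK // subset_leq_card.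
  have WZ1 : 0 < #|W| + #|Z| by rewrite -cWZ card_gt0.
  rewrite -/eW -/dZ in leW leZ.
  (* [leW] and [leZ] amount to |D'| <= s' < |V'| for s' = s - (|W| + |eW|). *)
  have [|||X XV' cX] := IH V' D' (fun i => E i :\: W) (s - (#|W| + #|eW|)).
  - lia.
  - move=> i; rewrite !inE negb_or => /andP[/andP[_]].
    move=> + iD; rewrite iD /= negbK => dEZ; apply/subsetP=> x.
    rewrite !inE negb_or => /andP[-> xE]; rewrite (subsetP (EV i iD) x xE) andbT /=.
    by apply: contraTN dEZ => xZ; apply/pred0Pn; exists x; rewrite /= xE.
  - by rewrite cWZ in WZV; lia.
  have XV : X \subset V by apply: subset_trans XV' (subsetDl _ _).
  have dXW : [disjoint W & X].
    rewrite -setI_eq0; apply/eqP/setP=> x; rewrite !inE.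
    apply/negP=> /andP[xW /(subsetP XV')]; rewrite !inE; by rewrite xW.
  exists (W :|: X); first by rewrite subUset WV.
  have -> : [set i in D | E i \subset W :|: X] =
            eW :|: [set i in D' | E i :\: W \subset X].
    apply/setP=> i; rewrite !inE; case iD: (i \in D) => /=; last by rewrite ?andbF.
    rewrite subDset negb_or negbK andbT.
    case: (boolP (E i \subset W)) => [EW|_] /=.
      by rewrite (subset_trans EW (subsetUl _ _)).
    case: (boolP (E i \subset W :|: X)) => [EWX|]; last by rewrite andbF.
    rewrite andbT; apply/esym; rewrite -setI_eq0; apply/eqP/setP=> x; rewrite !inE.
    apply/negP=> /andP[/(subsetP EWX)]; rewrite !inE => /orP[xW|xX] xZ.
      by have /pred0P/(_ x) := dWZ; rewrite /= xW xZ.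
    by have := subsetP XV' x xX; rewrite !inE xZ orbT.
  rewrite !cardsU (disjoint_setI0 dXW).
  have -> : eW :&: [set i in D' | E i :\: W \subset X] = set0.
    by apply/setP=> i; rewrite !inE; case: (i \in D); case: (E i \subset W).
  rewrite !cards0 !subn0; lia.
have [v0 v0V] : exists v, v \in V by apply/card_gt0P; lia.
have [V1|V1] := leqP #|V| 1.
  exists set0; first exact: sub0set.
  have D0 : #|D| = 0 by lia.
  suff -> : [set i in D | E i \subset set0] = set0 by rewrite !cards0; lia.
  by apply/eqP; rewrite -subset0 -(cards0_eq D0); apply/subsetP=> i /[!inE] /andP[].
(* Slack in |D| <= s lets a vertex be put into X; slack in s < |V| lets one be left out. Without
   slack, |V| = |D| + 1. *)
have [Ds'|sD] := ltnP #|D| s.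
  apply: (contract [set v0] set0); rewrite ?sub1set ?sub0set ?setU0 ?cards1 ?cards0 //.
  - by rewrite disjoint_sym disjoints_subset sub0set.
  - by apply/set0Pn; exists v0; rewrite inE.
  - lia.
  - lia.
have [sV'|Vs] := ltnP s.+1 #|V|.
  apply: (contract set0 [set v0]); rewrite ?sub1set ?sub0set ?set0U ?cards1 ?cards0 //.
  - by rewrite disjoints_subset sub0set.
  - by apply/set0Pn; exists v0; rewrite inE.
  - lia.
  - lia.
have cVD : #|V| = #|D|.+1 by lia.
have {}Ds : #|D| = s by lia.
(* An edge equal to V is never counted, since |X| <= s < |V|, so it can be deleted. *)
have [/'exists_andP[i [iD /eqP EiV]]|] := boolP [exists i, (i \in D) && (E i == V)].
  have [|j||X XV cX] := IH V (D :\ i) E s.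
  - by have := cardsD1 i D; rewrite iD; lia.
  - by rewrite !inE => /andP[_ /EV].
  - by have := cardsD1 i D; rewrite iD; lia.
  exists X => //; rewrite -cX; congr (_ + #|pred_of_set _|); apply/setP=> j.
  rewrite !inE; case: eqVneq => //= ->; rewrite EiV; apply/negP=> /andP[_ VX].
  have := subset_leq_card VX; lia.
rewrite negb_exists => /forallP full.
have EpV i : i \in D -> E i \proper V.
  by move=> iD; rewrite properEneq EV // andbT; have := full i; rewrite iD.
have [/'exists_andP[z [zV /forallP zE]]|] :=
    boolP [exists z, (z \in V) && [forall i, (i \in D) ==> (z \in E i)]].
  exists (V :\ z); first exact: subsetDl.
  suff -> : [set i in D | E i \subset V :\ z] = set0.
    by rewrite cards0 addn0; rewrite (cardsD1 z V) zV in cVD; lia.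
  apply/setP=> i; rewrite !inE subsetD1; have := zE i.
  by case: (i \in D) => //= ->; rewrite andbF.
rewrite negb_exists => /forallP miss.
have [z zV|z [i [zV iD zi Ei]]] := small_nonincident_edge cVD EpV.
  have := miss z; rewrite zV negb_forall => /existsP[i].
  by rewrite negb_imply => /andP[? ?]; exists i.
have dz : [set j in D | z \in E j] \subset D :\ i.
  apply/subsetP=> j; rewrite !inE => /andP[-> zj]; rewrite andbT.
  by apply: contraNneq zi => <-.
have dzi := subset_leq_card dz.
have cDi : #|D| = (#|D :\ i|).+1 by rewrite (cardsD1 i D) iD.
(* With |D| = s = |V| - 1, the first inequality of [contract] reads |E i| <= d(z); the second holds
   because edge i itself lies in W. *)
apply: (contract (E i) [set z]); rewrite ?sub1set ?EV // ?cards1.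
- by rewrite disjoint_sym disjoints1.
- by apply/set0Pn; exists z; rewrite !inE eqxx orbT.
- by rewrite setUC cardsU1 zi; lia.
- suff -> : [set j in D | ~~ [disjoint E j & [set z]]] = [set j in D | z \in E j].
    lia.
  by apply/setP=> j; rewrite !inE disjoint_sym disjoints1 negbK.
- have : 0 < #|[set j in D | E j \subset E i]|.
    by apply/card_gt0P; exists i; rewrite inE iD subxx.
  lia.
Qed.

(** * Closure systems: a closed set of size t *)

(** Two predicates, because intersecting weakens closedness: [hyp] is the strong form, [flat] the
    weak one. All sets H_x are intersected at once, so the loss occurs only once. *)
Lemma exists_closed_of_size (T : finType) (F : {set T}) (t : nat)
    (hyp flat : pred {set T}) :
    2 * t + 1 <= #|F| ->
    (forall S : {set T}, S \subset F -> #|S| < #|F| - t ->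
       exists A : {set T}, [/\ S \subset A, A \proper F & hyp A]) ->
    (forall S : {set T}, S \subset F ->
       (forall x, x \in F :\: S -> exists A : {set T},
          [/\ S \subset A, A \subset F, x \notin A & hyp A]) -> flat S) ->
  exists X : {set T}, [/\ X \subset F, #|X| = t & flat X].
Proof.
move=> tF cover meet.
pose spans (S : {set T}) := (S \subset F) &&
  [forall A : {set T}, (S \subset A) && (A \proper F) ==> ~~ hyp A].
have [B /minsetP[/andP[BF /forallP spB] minB] _] : {B | minset spans B & B \subset F}.
  apply: minset_exists; rewrite /spans subxx; apply/forallP=> A.
  by apply/implyP=> /andP[FA /properP[_ [x xF]]]; rewrite (subsetP FA).
have cB : #|F| - t <= #|B|.
  rewrite leqNgt; apply/negP=> /(cover B BF)[A [BA AF hA]].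
  by have := spB A; rewrite BA AF hA.
pose good x (A : {set T}) := [&& B :\ x \subset A, A \proper F & hyp A].
(* The default is never taken for x in B: by minimality B - x does not span, so some [A] is good. *)
pose H x := odflt set0 [pick A | good x A].
have HP x : x \in B -> [/\ B :\ x \subset H x, H x \proper F, hyp (H x) & x \notin H x].
  move=> xB; have ex : exists A, good x A.
    have Bx : B :\ x \subset B := subsetDl _ _.
    have : ~~ spans (B :\ x).
      apply/negP=> /minB/(_ Bx) eqB; have := xB; by rewrite -eqB !inE eqxx.
    rewrite /spans (subset_trans Bx BF) negb_forall => /existsP[A].
    by rewrite negb_imply negbK => /andP[/andP[? ?] ?]; exists A; apply/and3P.
  have : good x (H x).
    by rewrite /H; case: pickP => //= none; case: ex => A; rewrite none.
  case/and3P=> BH HF hH; split=> //; apply/negP=> xH.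
  have := spB (H x); rewrite HF hH andbT /= implybF => /negP; apply.
  by rewrite -(setD1K xB) subUset sub1set xH.
pose E e := [set x in B | e \notin H x].
have [||X XB cX] := @subset_with_weight _ _ B (F :\: B) E t.
- by move=> e _; apply/subsetP=> x; rewrite inE => /andP[].
- by rewrite cardsD (setIidPr BF); have := subset_leq_card BF; lia.
pose FX : {set T} := [set y in F | [forall (x | x \in B :\: X), y \in H x]].
have FXF : FX \subset F by apply/subsetP=> y; rewrite inE => /andP[].
exists FX; split=> //.
(* FX meets B exactly in X, since [H x] misses x and contains the rest of B; a point e outside B
   lies in FX iff [E e] is inside X. *)
- rewrite -(cardsID B FX) -cX; congr (_ + _); last first.
    apply: eq_card => e; rewrite !inE; case: (e \in B) => //=; case: (e \in F) => //=.
    apply/'forall_implyP/subsetP=> [eH x|EX x].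
      rewrite !inE => /andP[xB]; apply: contraR => xX; apply: eH.
      by rewrite !inE xX.
    by rewrite !inE => /andP[xX xB]; apply: contraR xX => eH; apply: EX; rewrite inE xB.
  apply: eq_card => y; rewrite !inE.
  have [yB|yB] /= := boolP (y \in B); last first.
    by rewrite andbF; apply/esym/negP=> /(subsetP XB); rewrite (negPf yB).
  rewrite (subsetP BF) // andbT /=; apply/'forall_implyP/idP=> [yH|yX x].
    apply: contraT => yX; have [_ _ _ /negP] := HP y yB; case.
    by apply: yH; rewrite !inE yX.
  rewrite !inE => /andP[xX xB]; have [/subsetP sub _ _ _] := HP x xB.
  by apply: sub; rewrite !inE yB andbT; apply: contraNneq xX => <-.
- apply: meet => // y.
  rewrite !inE => /andP[+ yF]; rewrite yF /= negb_forall => /existsP[x].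
  rewrite negb_imply => /andP[xBX yH]; exists (H x).
  have xB : x \in B by move: xBX; rewrite inE => /andP[].
  have [_ /proper_sub ? ? _] := HP x xB; split=> //.
  by apply/subsetP=> z; rewrite inE => /andP[_ /forallP/(_ x)]; rewrite xBX.
Qed.

(** * Degrees and exceptional members of a uniform family *)

Definition deg (T : finType) (FF : {set {set T}}) (S : {set T}) : nat :=
  #|[set F in FF | S \subset F]|.

Definition deg_closed (T : finType) (M : nat) (FF : {set {set T}})
    (F S : {set T}) : bool :=
  [forall x in F :\: S, M * deg FF (x |: S) <= deg FF S].

Lemma card_exists_leq (T I : finType) (FF : {set {set T}})
    (Q : I -> pred {set T}) :
  #|[set F in FF | [exists i, Q i F]]| <= \sum_i #|[set F in FF | Q i F]|.
Proof.
have -> : [set F in FF | [exists i, Q i F]] = \bigcup_i [set F in FF | Q i F].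
  apply/setP=> F; rewrite inE; apply/andP/bigcupP => [[FFF /existsP[i QF]]|[i _]].
    by exists i; rewrite // inE FFF.
  by rewrite inE => /andP[-> QF]; split=> //; apply/existsP; exists i.
apply: (big_ind2 (fun (A : {set {set T}}) m => #|A| <= m)) => [|A m B p Am Bp|//].
  by rewrite cards0.
exact: leq_trans (leq_card_setU A B).1 (leq_add Am Bp).
Qed.

Lemma intermediate_subset (T : finType) (A B : {set T}) (j : nat) :
  A \subset B -> #|A| <= j <= #|B| ->
  exists C : {set T}, [/\ A \subset C, C \subset B & #|C| = j].
Proof.
move=> AB /andP[Aj jB].
have : 0 < #|[set C : {set T} | C \subset B :\: A & #|C| == j - #|A|]|.
  by rewrite cards_draws bin_gt0 cardsD (setIidPr AB) leq_sub2r.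
case/card_gt0P=> C /[!inE] /andP[CBA /eqP cC].
exists (A :|: C); split; first exact: subsetUl.
  by rewrite subUset AB (subset_trans CBA) ?subsetDl.
have dAC : [disjoint A & C].
  by rewrite disjoint_sym disjoints_subset (subset_trans CBA) // setDE subsetIr.
by rewrite cardsU (disjoint_setI0 dAC) cards0 subn0 cC subnKC.
Qed.

Lemma leq_deg (T : finType) (FF : {set {set T}}) (A B : {set T}) :
  A \subset B -> deg FF B <= deg FF A.
Proof.
move=> AB; apply/subset_leq_card/subsetP=> F; rewrite !inE => /andP[-> BF].
exact: subset_trans BF.
Qed.

Section Uniform.
Variables (T : finType) (k : nat) (FF : {set {set T}}).
Hypothesis uniform : forall F, F \in FF -> #|F| = k.

Lemma deg_edge F : F \in FF -> deg FF F <= 1.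
Proof.
move=> FFF; rewrite -(cards1 F); apply/subset_leq_card/subsetP=> G.
rewrite !inE eq_sym => /andP[GFF FG].
by rewrite eqEcard FG !uniform //=.
Qed.

(** Double count of pairs (x, F) with S inside F and x in F outside S: each F offers at most k
    points. *)
Lemma sum_deg_setU1 (S : {set T}) :
  \sum_(x in ~: S) deg FF (x |: S) <= k * deg FF S.
Proof.
have degE x : deg FF (x |: S) = \sum_(F in FF | S \subset F) (x \in F).
  rewrite /deg -sum1dep_card big_mkcondr [RHS]big_mkcondr /=.
  by apply: eq_bigr => F _; rewrite subUset sub1set; case: (S \subset F); case: (x \in F).
rewrite (eq_bigr _ (fun x _ => degE x)) exchange_big /=.
rewrite mulnC /deg -sum_nat_const.
rewrite [X in _ <= X](eq_bigl (fun F => (F \in FF) && (S \subset F))); last first.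
  by move=> F; rewrite inE.
apply: leq_sum => F /andP[FFF SF].
rewrite -(uniform FFF) -big_mkcondr sum1_card /=.
by apply/subset_leq_card/subsetP=> x /andP[].
Qed.

(** The obstructions to closedness: S is M-closed in F iff F avoids [heavy M S]. *)
Definition heavy (M : nat) (S : {set T}) : {set T} :=
  [set x in ~: S | deg FF S < M * deg FF (x |: S)].

(** Each heavy point carries more than a 1/M share of the degree of S, and by [sum_deg_setU1] all
    shares add up to at most k. *)
Lemma card_heavy M S : #|heavy M S| <= M * k.
Proof.
have [S0|S0] := posnP (deg FF S).
  suff -> : heavy M S = set0 by rewrite cards0.
  apply/setP=> x; rewrite !inE; apply/negP=> /andP[_].
  have : deg FF (x |: S) <= deg FF S := leq_deg _ (subsetUr _ _).
  by rewrite S0 leqn0 => /eqP->; rewrite muln0.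
rewrite -(leq_pmul2r S0) -mulnA -sum_nat_const.
apply: leq_trans (leq_mul (leqnn M) (sum_deg_setU1 S)).
rewrite big_distrr /= (bigID (mem (heavy M S)) (mem (~: S))) /=.
apply: leq_trans (leq_addr _ _).
rewrite [X in _ <= X](eq_bigl (mem (heavy M S))).
  by apply: leq_sum => x; rewrite !inE => /andP[_ /ltnW].
by move=> x; rewrite !inE; case: (x \in S).
Qed.

Definition sparse (j D : nat) : {set {set T}} :=
  [set F in FF | [exists S : {set T},
     [&& #|S| == j, deg FF S <= D & S \subset F]]].

(** Each j-set of degree at most D accounts for at most D members. For j = k - t - 1 and constant D
    this is O(n^(k-t-1)), hence o(l). *)
Lemma card_sparse j D : #|sparse j D| <= 'C(#|T|, j) * D.
Proof.
apply: leq_trans (card_exists_leq _ _) _.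
rewrite -card_draws -sum_nat_const [X in _ <= X]big_mkcond /=.
apply: leq_sum => S _; rewrite inE.
case: (boolP (#|S| == j)) => [_|_] /=; last first.
  by rewrite leqn0 cards_eq0; apply/eqP/setP=> F; rewrite !inE andbF.
case: (leqP (deg FF S) D) => [le|_] //=; apply: leq_trans (leq0n D).
by rewrite leqn0 cards_eq0; apply/eqP/setP=> F; rewrite !inE andbF.
Qed.

(* For F outside this set, intersections of M'-closed subsets of F are M-closed. *)
Definition irregular (M M' : nat) : {set {set T}} :=
  [set F in FF | [exists A : {set T}, [exists I : {set T}, [exists x : T,
     [&& I \subset A, x \in heavy M I, M' * deg FF (x |: A) <= deg FF A
       & x |: A \subset F]]]]].

(** Given A, I and x, at most deg(A) / M' members qualify. There are at most M k heavy x for each I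
    and 2^k sets I inside A; the degrees of all A sum to 2^k |FF|, which gives 4^k. *)
Lemma card_irregular M M' :
  M' * #|irregular M M'| <= 4 ^ k * k * M * #|FF|.
Proof.
have bound (A I : {set T}) (x : T) :
    M' * #|[set F in FF | [&& I \subset A, x \in heavy M I,
       M' * deg FF (x |: A) <= deg FF A & x |: A \subset F]]| <=
    (if (I \subset A) then (if (x \in heavy M I) then deg FF A else 0) else 0).
  have zero b : b = false -> M' * #|[set F in FF | b && (x |: A \subset F)]| <= 0.
    move=> ->; rewrite leqn0 muln_eq0 cards_eq0; apply/orP; right.
    by apply/eqP/setP=> F; rewrite !inE andbF.
  case: (boolP (I \subset A)) => _ /=; last exact: (zero false erefl).
  case: (boolP (x \in heavy M I)) => _ /=; last exact: (zero false erefl).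
  by case: (leqP (M' * deg FF (x |: A)) (deg FF A)) => //= _; rewrite (leq_trans (zero false erefl)).
apply: (@leq_trans (\sum_(A : {set T}) 2 ^ #|A| * (M * k * deg FF A))).
  apply: leq_trans (leq_mul (leqnn _) (card_exists_leq _ _)) _.
  rewrite big_distrr /=; apply: leq_sum => A _.
  apply: leq_trans (leq_mul (leqnn _) (card_exists_leq _ _)) _.
  rewrite -card_powerset -sum_nat_const big_distrr [X in _ <= X]big_mkcond /=.
  apply: leq_sum => I _; rewrite inE.
  apply: leq_trans (leq_mul (leqnn _) (card_exists_leq _ _)) _.
  rewrite big_distrr /=.
  apply: (@leq_trans (\sum_x
      if I \subset A then if x \in heavy M I then deg FF A else 0 else 0)).
    by apply: leq_sum => x _; exact: bound.
  case: (I \subset A); last by rewrite big1.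
  by rewrite -big_mkcond sum_nat_const leq_mul2r card_heavy orbT.
have degE (A : {set T}) : 2 ^ #|A| * (M * k * deg FF A) <=
    \sum_(F in FF) (if A \subset F then 2 ^ k * (M * k) else 0).
  rewrite -big_mkcondr sum_nat_const mulnA mulnC.
  rewrite [X in X * _ <= _](_ : _ = #|[pred F in FF | A \subset F]|); last first.
    by apply: eq_card => F; rewrite !inE.
  have [->//|/card_gt0P[F]] := posnP #|[pred F in FF | A \subset F]|.
  rewrite !inE => /andP[FFF AF]; rewrite leq_mul2l leq_mul2r leq_exp2l //.
  by rewrite -(uniform FFF) subset_leq_card ?orbT.
apply: (@leq_trans (\sum_(A : {set T}) \sum_(F in FF)
    if A \subset F then 2 ^ k * (M * k) else 0)).
  by apply: leq_sum => A _; exact: degE.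
rewrite exchange_big /= [X in _ <= X]mulnC -sum_nat_const; apply: leq_sum => F FFF.
rewrite -big_mkcond sum_nat_const /=.
rewrite (_ : #|_| = 2 ^ k); last first.
  by rewrite -(uniform FFF) -card_powerset; apply: eq_card => A; rewrite !inE.
by rewrite mulnA -expnMn mulnA mulnAC.
Qed.

(** Avoiding [sparse] yields the covering hypothesis of [exists_closed_of_size], avoiding
    [irregular] the one on intersections. The threshold [M' ^ k] is the largest weight that F itself
    can have in the maximization. *)
Lemma exists_deg_closed t M M' (F : {set T}) :
    2 * t + 1 <= k -> 0 < M' -> F \in FF ->
    F \notin sparse (k - t - 1) (M' ^ k) -> F \notin irregular M M' ->
  exists X : {set T}, [/\ X \subset F, #|X| = t & deg_closed M FF F X].
Proof.
move=> tk M'0 FFF dense regular; have cF := uniform FFF.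
apply: (@exists_closed_of_size _ _ _ (deg_closed M' FF F)); rewrite ?cF //.
  move=> S SF cS.
  have [|S' [SS' S'F cS']] := @intermediate_subset _ S F (k - t - 1) SF.
    by lia.
  have degS : M' ^ k < deg FF S.
    apply: leq_trans (leq_deg _ SS'); rewrite ltnNge; apply: contra dense => le.
    by rewrite inE FFF; apply/existsP; exists S'; rewrite cS' eqxx le.
  pose P (A : {set T}) := (S \subset A) && (A \subset F).
  have PS : P S by rewrite /P subxx.
  (* A set maximizing d(A) * M' ^ |A| is closed, and F does not beat S. *)
  case: (arg_maxnP (fun A : {set T} => deg FF A * M' ^ #|A|) PS) => A /andP[SA AF] maxA.
  exists A; split=> //.
    rewrite properEneq AF andbT; apply: contraTneq (maxA S PS) => ->.
    rewrite -ltnNge cF; apply: leq_ltn_trans (leq_mul (deg_edge FFF) (leqnn _)) _.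
    by rewrite mul1n (leq_trans degS) // leq_pmulr // expn_gt0 M'0.
  apply/'forall_implyP=> x /[!inE] /andP[xA xF].
  have := maxA (x |: A); rewrite /P subUset sub1set xF AF.
  rewrite (subset_trans SA (subsetUr _ _)) cardsU1 xA expnS => /(_ isT).
  by rewrite /geq /= mulnA leq_pmul2r ?expn_gt0 ?M'0 // mulnC.
(* Were x heavy for S, the M'-closed A around S that misses x would make F irregular, with I = S. *)
move=> S SF far; apply/'forall_implyP=> x xFS.
have [A [SA AF xA /'forall_implyP/(_ x) lightA]] := far x xFS.
have [xF xS] : x \in F /\ x \notin S by move: xFS; rewrite inE => /andP[].
rewrite leqNgt; apply: contra regular => heavyS; rewrite inE FFF /=.
apply/existsP; exists A; apply/existsP; exists S; apply/existsP; exists x.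
by rewrite SA !inE xS heavyS lightA ?inE ?xA // subUset sub1set xF.
Qed.

(** A member through X meeting F in more than X contains [x |: X] for one of at most k points x of
    F, and closedness allows at most deg(X) / M members for each. *)
Lemma deg_closed_meet M F (X : {set T}) : F \in FF -> X \subset F -> deg_closed M FF F X ->
  M * deg FF X <= M * #|[set G in FF | F :&: G == X]| + k * deg FF X.
Proof.
move=> FFF XF /'forall_implyP light.
have : deg FF X <= #|[set G in FF | F :&: G == X]| +
                   \sum_(x in F :\: X) deg FF (x |: X).
  have sub : [set G in FF | X \subset G] \subset [set G in FF | F :&: G == X] :|:
      [set G in FF | [exists x, (x \in F :\: X) && (x |: X \subset G)]].
    apply/subsetP=> G; rewrite !inE => /andP[-> XG] /=.
    have [//|/= FGX] := eqVneq; have : ~~ (F :&: G \subset X).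
      by apply: contra FGX => FGX; rewrite eqEsubset FGX subsetI XF.
    case/subsetPn=> x /[!inE] /andP[xF xG] xX; apply/existsP; exists x.
    by rewrite !inE xX xF subUset sub1set xG.
  apply: leq_trans (subset_leq_card sub) _.
  apply: leq_trans (leq_card_setU _ _).1 _; rewrite leq_add2l.
  apply: leq_trans (card_exists_leq _ _) _; rewrite [X in _ <= X]big_mkcond.
  apply: leq_sum => x _; case: ifP => //= _.
  by rewrite leqn0 cards_eq0; apply/eqP/setP=> G; rewrite !inE andbF.
move/(leq_mul (leqnn M))/leq_trans; apply; rewrite mulnDr leq_add2l big_distrr.
apply: (@leq_trans (\sum_(x in F :\: X) deg FF X)); first exact: leq_sum.
rewrite sum_nat_const leq_mul2r.
by rewrite -(uniform FFF) subset_leq_card ?subsetDl ?orbT.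
Qed.

End Uniform.

(** * From closed t-subsets to edges *)

Lemma sqr_sum_leq (I : finType) (A : {set I}) (a : I -> nat) :
  (\sum_(i in A) a i) ^ 2 <= #|A| * \sum_(i in A) a i ^ 2.
Proof.
rewrite -(leq_pmul2l (isT : 0 < 2)).
have -> : 2 * (#|A| * \sum_(i in A) a i ^ 2) =
          \sum_(i in A) \sum_(j in A) (a i ^ 2 + a j ^ 2).
  under [RHS]eq_bigr => i _ do rewrite big_split sum_nat_const /=.
  by rewrite big_split /= -big_distrr sum_nat_const /=; lia.
rewrite -mulnn big_distrl big_distrr leq_sum //= => i _.
rewrite big_distrr big_distrr leq_sum //= => j _.
exact: nat_Cauchy.
Qed.

Lemma bin_fact_leq_exp n m : 'C(n, m) * m`! <= n ^ m.
Proof.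
rewrite bin_ffact; elim: m n => [|m IH] n; first by rewrite ffactn0.
by rewrite ffactnSr expnSr leq_mul // leq_subr.
Qed.

Definition meeting_pairs (T : finType) (t : nat) (FF : {set {set T}}) :=
  [set p in setX FF FF | #|p.1 :&: p.2| == t].

(** Since t < k there are no diagonal pairs, and an edge arises from at most two ordered pairs. *)
Lemma card_meeting_pairs n k t (FF : {set {set 'I_n}}) :
  t < k -> FF \subset ksets n k -> #|meeting_pairs t FF| <= 2 * rho_fam t FF.
Proof.
move=> tk /subsetP FFk; rewrite /rho_fam; set edges := imset2 _ _ _.
rewrite mulnC -sum_nat_const.
have to_edge p : p \in meeting_pairs t FF -> [set p.1; p.2] \in edges.
  case: p => A B; rewrite !inE /= => /andP[/andP[AF BF] tAB].
  apply/imset2P; exists A B => //; rewrite inE BF /johnson_adj tAB andbT /=.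
  apply: contraTneq tAB => <-; rewrite setIid.
  by have := FFk A AF; rewrite inE => /eqP->; rewrite gtn_eqF.
rewrite -sum1_card (partition_big (fun p => [set p.1; p.2]) (mem edges)) //=.
apply: leq_sum => E /imset2P[A B AF /[!inE] /andP[BF AB] ->].
rewrite sum1_card; apply: leq_trans (_ : #|[set (A, B); (B, A)]| <= 2).
  apply/subset_leq_card/subsetP=> -[C D] /andP[_ /eqP/= eqCD]; rewrite !inE.
  have C2 : C \in [set A; B] by rewrite -eqCD !inE eqxx.
  have D2 : D \in [set A; B] by rewrite -eqCD !inE eqxx orbT.
  have A2 : A \in [set C; D] by rewrite eqCD !inE eqxx.
  have B2 : B \in [set C; D] by rewrite eqCD !inE eqxx orbT.
  move: C2 D2 A2 B2 AB; rewrite !inE !xpair_eqE => /orP[]/eqP-> /orP[]/eqP->;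
    rewrite ?eqxx ?orbT //= ?orbb.
    by move=> _ /eqP->; rewrite eqxx.
  by move=> /eqP->; rewrite eqxx.
by rewrite cards2; case: (_ != _).
Qed.

Lemma sqr_card_leq_pairs (T : finType) (k t M : nat) (FF G : {set {set T}}) :
    (forall F, F \in FF -> #|F| = k) -> G \subset FF ->
    (forall F, F \in G -> exists X : {set T},
       [/\ X \subset F, #|X| = t & deg_closed M FF F X]) ->
  (M - k) * #|G| ^ 2 <= M * 'C(#|T|, t) * #|meeting_pairs t FF|.
Proof.
move=> uniform /subsetP GF ex.
pose good (F X : {set T}) := [&& X \subset F, #|X| == t & deg_closed M FF F X].
pose X F := odflt set0 [pick X | good F X].
have XP F : F \in G -> [/\ X F \subset F, #|X F| = t & deg_closed M FF F (X F)].
  move=> /ex[Y [YF cY clY]]; have : good F (X F).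
    rewrite /X; case: pickP => //= /(_ Y).
    by rewrite /good YF cY clY eqxx.
  by case/and3P=> ? /eqP.
pose tsets := [set Y : {set T} | #|Y| == t].
pose g Y := #|[set F in G | X F == Y]|.
have sumG (h : {set T} -> nat) :
    \sum_(F in G) h (X F) = \sum_(Y in tsets) g Y * h Y.
  rewrite (partition_big X (mem tsets)) => [|F FG] /=; last first.
    by rewrite inE; have [_ -> _] := XP F FG.
  apply: eq_bigr => Y _; rewrite -sum_nat_const.
  rewrite [RHS](eq_bigl (fun F => (F \in G) && (X F == Y))); last first.
    by move=> F; rewrite inE.
  by apply: eq_bigr => F /andP[_ /eqP->].
(* Cauchy-Schwarz over the fibres of [X]. Bounding only one factor of [g Y ^ 2] by deg(Y) turns the
   sum over Y back into a sum over G. *)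
have step1 : #|G| ^ 2 <= 'C(#|T|, t) * \sum_(F in G) deg FF (X F).
  rewrite -[#|G|]sum1_card (sumG (fun=> 1)).
  under eq_bigr do rewrite muln1.
  apply: leq_trans (sqr_sum_leq _ _) _; rewrite card_draws leq_mul2l; apply/orP; right.
  rewrite sumG; apply: leq_sum => Y _; rewrite -mulnn leq_mul2l; apply/orP; right.
  apply/subset_leq_card/subsetP=> F; rewrite !inE => /andP[FG /eqP <-].
  by rewrite GF //; have [] := XP F FG.
have step2 : \sum_(F in G) #|[set H in FF | F :&: H == X F]| <= #|meeting_pairs t FF|.
  have -> : #|meeting_pairs t FF| = \sum_(F in FF) #|[set H in FF | #|F :&: H| == t]|.
    rewrite -sum1_card /=; under [RHS]eq_bigr => F _ do rewrite -sum1_card.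
    rewrite pair_big_dep /=; apply: eq_bigl => -[F H]; rewrite !inE /=.
    by rewrite andbA.
  rewrite (bigID (mem G) (mem FF)) /=; apply: leq_trans (leq_addr _ _).
  rewrite [X in _ <= X](eq_bigl (mem G)) => [|F]; last first.
    by rewrite /= andb_idl //; exact: GF.
  apply: leq_sum => F FG; apply/subset_leq_card/subsetP=> H; rewrite !inE.
  by case/andP=> -> /eqP->; have [_ -> _] := XP F FG; rewrite eqxx.
have step3 : (M - k) * \sum_(F in G) deg FF (X F) <=
    M * \sum_(F in G) #|[set H in FF | F :&: H == X F]|.
  rewrite !big_distrr /=; apply: leq_sum => F FG; have [XF _ clX] := XP F FG.
  by have := deg_closed_meet uniform (GF F FG) XF clX; rewrite mulnBl leq_subLR addnC.
apply: leq_trans (leq_mul (leqnn (M - k)) step1) _.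
rewrite mulnCA -mulnA [M * _]mulnCA leq_mul2l; apply/orP; right.
exact: leq_trans step3 (leq_mul (leqnn M) step2).
Qed.

(** The loss is the factor (1 - k/M)(1 - 2/M)^2, near 1 for large M: k/M comes from
    [deg_closed_meet], 2/M from discarding sparse and irregular members. *)
Lemma rho_lower_bound n k t l M :
    2 * t + 1 <= k -> l <= 'C(n, k) ->
    M * (n ^ (k - t - 1) * (4 ^ k * k * M ^ 2) ^ k) <= l ->
  (M - k) * (M - 2) ^ 2 * l ^ 2 * t`! <= 2 * M ^ 3 * n ^ t * rho n k t l.
Proof.
move=> tk ln lM; have [FF [FFk cFF ->]] := rho_attained t ln.
have [->|M0] := posnP M; first by rewrite sub0n !mul0n.
have uniform F : F \in FF -> #|F| = k.
  by move/(subsetP FFk); rewrite inE => /eqP.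
(* This value makes [card_irregular] bound the irregular members by l/M. *)
set M' := 4 ^ k * k * M ^ 2 in lM; set j := k - t - 1 in lM.
pose G := FF :\: (sparse FF j (M' ^ k) :|: irregular FF M M').
have M'0 : 0 < M' by rewrite !muln_gt0 !expn_gt0 M0 /=; lia.
have cS : M * #|sparse FF j (M' ^ k)| <= l.
  apply: leq_trans lM; rewrite leq_mul2l; apply/orP; right.
  apply: leq_trans (card_sparse _ _ _) _; rewrite card_ord leq_mul2r; apply/orP; right.
  by apply: leq_trans (bin_fact_leq_exp n j); rewrite leq_pmulr // fact_gt0.
have cI : M * #|irregular FF M M'| <= l.
  have := card_irregular uniform M M'; rewrite cFF.
  have -> : M' = 4 ^ k * k * M * M by rewrite /M'; lia.
  by rewrite -!mulnA !leq_pmul2l ?expn_gt0 //; lia.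
have cG : (M - 2) * l <= M * #|G|.
  have : l <= #|sparse FF j (M' ^ k)| + #|irregular FF M M'| + #|G|.
    rewrite -cFF -(cardsID (sparse FF j (M' ^ k) :|: irregular FF M M') FF) leq_add2r.
    apply: leq_trans (leq_card_setU _ _).1.
    by apply/subset_leq_card/subsetP=> F /setIP[].
  move/(leq_mul (leqnn M)); rewrite !mulnDr mulnBl leq_subLR => /leq_trans; apply.
  by rewrite leq_add2r mul2n -addnn leq_add.
have GP F : F \in G -> exists X : {set 'I_n},
    [/\ X \subset F, #|X| = t & deg_closed M FF F X].
  rewrite inE inE negb_or => /andP[/andP[dense regular] FFF].
  exact: (exists_deg_closed uniform tk M'0 FFF dense regular).
have := sqr_card_leq_pairs uniform (subsetDl _ _ : G \subset FF) GP.
rewrite card_ord => pairs.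
have edges : #|meeting_pairs t FF| <= 2 * rho_fam t FF.
  by apply: card_meeting_pairs FFk; lia.
apply: (@leq_trans ((M - k) * (M * #|G|) ^ 2 * t`!)).
  by rewrite leq_mul2r -mulnA -expnMn leq_mul2l leq_sqr cG !orbT.
apply: (@leq_trans (M ^ 2 * (M * 'C(n, t) * #|meeting_pairs t FF|) * t`!)).
  by rewrite leq_mul2r expnMn mulnCA leq_mul2l pairs !orbT.
have fact_n := bin_fact_leq_exp n t.
apply: (@leq_trans (M ^ 3 * ('C(n, t) * t`!) * #|meeting_pairs t FF|)).
  by apply: eq_leq; rewrite !expnS expn0; lia.
apply: (@leq_trans (M ^ 3 * n ^ t * (2 * rho_fam t FF))).
  by rewrite leq_mul // leq_mul2l fact_n orbT.
by apply: eq_leq; lia.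
Qed.

(* Passage to the limit *)
From mathcomp Require Import all_classical all_reals all_analysis.
Import numFieldNormedType.Exports.
Local Open Scope classical_set_scope.
Local Open Scope ring_scope.

(** The remaining terms of the expansion, 4(k + 1)M - 4k, are nonnegative. *)
Lemma lower_constant (R : realType) (k M : nat) : (k < M)%N -> (2 < M)%N ->
  (M%:R ^+ 3 - (k + 4)%:R * M%:R ^+ 2 : R) <= ((M - k) * (M - 2) ^ 2)%:R.
Proof.
move=> kM tM; rewrite natrM natrX !natrB ?(ltnW kM) ?(ltnW tM) // natrD.
have k0 : 0 <= k%:R :> R by [].
have M2 : 2 <= M%:R :> R by rewrite ler_nat ltnW.
have kM' : k%:R <= M%:R :> R by rewrite ler_nat ltnW.
nra.
Qed.

Theorem theorem4 (R : realType) (k t : nat) (k_gt0 : (0 < k)%N)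
    (t_gt0 : (0 < t)%N) (le_tk : (2 * t + 1 <= k)%N) (l : nat -> nat)
    (le_l : forall n : nat, (l n <= 'C(n, k))%N)
    (l_large : (fun n : nat => n%:R ^+ (k - t - 1) : R)
                 =o_\oo (fun n : nat => (l n)%:R : R)) :
  exists2 e : nat -> R,
    e =o_\oo (fun _ : nat => 1 : R) &
    \forall n \near \oo,
      (rho n k t (l n))%:R >=
        (1 + e n) * ((l n)%:R ^+ 2 / n%:R ^+ t) * (t`!%:R / 2).
Proof.
pose D n : R := (l n)%:R ^+ 2 / n%:R ^+ t * (t`!%:R / 2).
have D0 n : 0 <= D n by rewrite /D !mulr_ge0 ?invr_ge0 ?exprn_ge0.
(* The inequality then holds for every n, and truncation at 0 leaves only [e n >= - eps] to prove
   for large n. *)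
exists (fun n => Num.min 0 ((rho n k t (l n))%:R / D n - 1)); last first.
  apply: nearW => n; rewrite -mulrA -/(D n).
  have [->|Dn] := eqVneq (D n) 0; first by rewrite mulr0.
  rewrite -ler_pdivlMr ?lt0r ?Dn ?D0 // addrC -lerBrDr.
  by rewrite ge_min lexx orbT.
apply/eqoP => eps eps0.
(* (k + 4)/M is the relative loss in [lower_constant]. *)
have [M [kM tM epsM]] : exists M : nat,
    [/\ (k < M)%N, (2 < M)%N & (k + 4)%:R <= eps * M%:R].
  move: (truncnS_gt ((k + 4)%:R / eps)); move: (Num.truncn _) => m ltm.
  exists (m + k + 4)%N; split; [lia | lia |].
  rewrite mulrC -ler_pdivrMr //; apply: ltW; apply: lt_le_trans ltm _.
  by rewrite ler_nat; lia.
have M0 : (0 < M)%N by lia.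
pose M' := (4 ^ k * k * M ^ 2)%N.
have M'0 : (0 < M')%N by rewrite !muln_gt0 !expn_gt0 M0 k_gt0.
(* The little-o hypothesis with this constant is the size condition of [rho_lower_bound]. *)
have c0 : 0 < ((M * M' ^ k)%:R^-1 : R) by rewrite invr_gt0 ltr0n muln_gt0 expn_gt0 M'0 M0.
have /eqoP/(_ _ c0) large := l_large.
near=> n; rewrite normr1 mulr1.
have n0 : (0 < n)%N by near: n; exact: nbhs_infty_gt.
have lM : (M * (n ^ (k - t - 1) * M' ^ k) <= l n)%N.
  have : `|n%:R ^+ (k - t - 1) : R| <= (M * M' ^ k)%:R^-1 * `|(l n)%:R : R|.
    by near: n.
  rewrite -natrX !normr_nat mulrC ler_pdivlMr ?ltr0n ?muln_gt0 ?expn_gt0 ?M'0 ?M0 //.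
  rewrite -natrM ler_nat; lia.
have l0 : (0 < l n)%N.
  by apply: leq_trans lM; rewrite !muln_gt0 !expn_gt0 M0 n0 M'0.
have Dn : 0 < D n.
  rewrite /D; do ![apply: mulr_gt0]; rewrite ?invr_gt0 ?exprn_gt0 ?ltr0n //.
  exact: fact_gt0.
have := rho_lower_bound le_tk (le_l n) lM.
set r := rho _ _ _ _ => low.
have : (1 - eps) * D n <= r%:R.
  have nt0 : 0 < n%:R ^+ t :> R by rewrite exprn_gt0 ?ltr0n.
  have M30 : 0 < M%:R ^+ 3 :> R by rewrite exprn_gt0 ?ltr0n.
  have {}low : ((M - k) * (M - 2) ^ 2)%:R * ((l n)%:R ^+ 2 * t`!%:R) <=
      2 * M%:R ^+ 3 * n%:R ^+ t * r%:R :> R.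
    by rewrite -!natrX -!natrM ler_nat mulnA.
  have eps_c : (1 - eps) * M%:R ^+ 3 <= ((M - k) * (M - 2) ^ 2)%:R.
    apply: le_trans (lower_constant R kM tM).
    have M20 : 0 <= M%:R ^+ 2 :> R by rewrite exprn_ge0.
    have := ler_wpM2r M20 epsM; rewrite -mulrA -exprS; lra.
  have lt0 : 0 <= (l n)%:R ^+ 2 * t`!%:R :> R by rewrite mulr_ge0 ?exprn_ge0.
  have := ler_wpM2r lt0 eps_c => /le_trans/(_ low) {}low.
  have -> : (1 - eps) * D n =
      (1 - eps) * M%:R ^+ 3 * ((l n)%:R ^+ 2 * t`!%:R) / (2 * M%:R ^+ 3 * n%:R ^+ t).
    by rewrite /D; field; rewrite ?(gt_eqF nt0) ?pnatr_eq0 -?lt0n ?n0 ?M0.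
  have den0 : 0 < 2 * M%:R ^+ 3 * n%:R ^+ t :> R.
    by rewrite !(mulr_gt0, nt0, M30) ?ltr0n.
  by rewrite ler_pdivrMr // [leRHS]mulrC.
rewrite -ler_pdivlMr // => rD.
rewrite ler_norml le_min ge_min oppr_le0 (ltW eps0) /= andbT; lra.
Unshelve. all: by end_near.
Qed.
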